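(* For every integer $n\ge 2$, the group $F_n\times\mathbb{Z}$ has a finitely generated positive cone if and only if $n$ is even.
   Context: $F_n$ denotes the free group of rank $n$. A positive cone of a group $G$ is a subsemigroup $P\subseteq G$ (a subset closed under multiplication) such that $G=P\sqcup P^{-1}\sqcup\{1\}$ (disjoint union), where $P^{-1}=\{p^{-1}:p\in P\}$. For $S\subseteq G$, $\langle S\rangle^+$ denotes the semigroup of all non-empty products $s_1\cdots s_\ell$ with $s_i\in S$ and $\ell\ge 1$. A positive cone $P$ is finitely generated if $P=\langle S\rangle^+$ for some finite set $S$. *)

(* Defs.v *)
From HB Require Import structures.
From mathcomp Require Import all_boot all_order all_algebra.
From mathcomp Require Import boolp classical_sets functions cardinality.

Set Implicit Arguments.
Unset Strict Implicit.
Unset Printing Implicit Defensive.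

Local Open Scope classical_set_scope.
Local Open Scope group_scope.

Section PositiveCone.
Context {G : groupType}.
Implicit Types P S : set G.

Definition positive_cone P : Prop :=
  let Pinv := [set p^-1 | p in P] in
  [/\ forall x y : G, P x -> P y -> P (x * y),
      P `|` Pinv `|` [set 1] = [set: G],
      P `&` Pinv = set0,
      P `&` [set 1] = set0 &
      Pinv `&` [set 1] = set0].

Definition semigroup_span S : set G :=
  [set x | exists s : seq G,
     [/\ s != [::], {in s, forall y, S y} & x = \prod_(y <- s) y]].

Definition finitely_generated P : Prop :=
  exists2 S : set G, finite_set S & P = semigroup_span S.

End PositiveCone.

(* The free group on T, realised as the reduced words in the letters
   (x, false) = x and (x, true) = x^-1, multiplied by concatenation followed
   by free reduction. *)
Section FreeGroup.
Variable T : choiceType.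
Implicit Types (a b : T * bool) (u v w : seq (T * bool)).

Definition letter_inv a : T * bool := (a.1, ~~ a.2).

Definition reduced w : bool := sorted (fun a b => b != letter_inv a) w.

Definition cons_reduce a w : seq (T * bool) :=
  if w is b :: w' then if b == letter_inv a then w' else a :: w else [:: a].

Definition mul_word u v : seq (T * bool) := foldr cons_reduce v u.

Definition inv_word u : seq (T * bool) := rev (map letter_inv u).

Lemma letter_invK : involutive letter_inv.
Proof. by case=> x b; rewrite /letter_inv /= negbK. Qed.

Lemma cons_reduce_reduced a w : reduced w -> reduced (cons_reduce a w).
Proof.
case: w => [//|b w] /=; case: eqVneq => [_|ab] pw; first exact: path_sorted pw.
by rewrite /= ab.
Qed.

Lemma mul_word_reduced u v : reduced v -> reduced (mul_word u v).
Proof. by move=> rv; elim: u => //= a u; apply: cons_reduce_reduced. Qed.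

Lemma cons_reduceK a w :
  reduced w -> cons_reduce a (cons_reduce (letter_inv a) w) = w.
Proof.
case: w => [|b w] /=; first by rewrite eqxx.
rewrite letter_invK; case: eqVneq => [->|_ _]; last by rewrite /= eqxx.
by case: w => [//|c w] /= /andP[/negPf ->].
Qed.

Lemma mul_word_cons a u v :
  reduced v -> mul_word (cons_reduce a u) v = cons_reduce a (mul_word u v).
Proof.
move=> rv; case: u => [//|b u] /=; case: eqVneq => [->|//].
by rewrite cons_reduceK //; apply: mul_word_reduced.
Qed.

Lemma mul_wordA u v w :
  reduced w -> mul_word u (mul_word v w) = mul_word (mul_word u v) w.
Proof. by move=> rw; elim: u => //= a u ->; rewrite mul_word_cons. Qed.

Lemma mul_word0 u : reduced u -> mul_word u [::] = u.
Proof.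
elim: u => //= a u IH rau; rewrite (IH (path_sorted rau)).
by case: u rau {IH} => [//|b u] /= /andP[/negPf ->].
Qed.

Lemma inv_wordK : involutive inv_word.
Proof.
by move=> u; rewrite /inv_word map_rev revK -map_comp (eq_map letter_invK) map_id.
Qed.

Lemma inv_word_reduced u : reduced u -> reduced (inv_word u).
Proof.
rewrite /reduced /inv_word rev_sorted sorted_map; apply: sub_sorted => a b /=.
by rewrite letter_invK eq_sym.
Qed.

Lemma mul_inv_word u : reduced u -> mul_word (inv_word u) u = [::].
Proof.
elim: u => //= a u IH rau; have ru := path_sorted rau.
by rewrite /inv_word /= rev_cons /mul_word foldr_rcons /= letter_invK eqxx; apply: IH.
Qed.

Record free_group := FreeGroup { fg_word :> seq (T * bool); _ : reduced fg_word }.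

HB.instance Definition _ := [isSub for fg_word].
HB.instance Definition _ := [Choice of free_group by <:].

Implicit Types x y z : free_group.

Lemma fg_reduced x : reduced x. Proof. exact: (valP x). Qed.

Definition fg_one : free_group := @FreeGroup [::] isT.
Definition fg_mul x y := FreeGroup (mul_word_reduced x (fg_reduced y)).
Definition fg_inv x := FreeGroup (inv_word_reduced (fg_reduced x)).

Lemma fg_mulA : associative fg_mul.
Proof. by move=> x y z; apply/val_inj/mul_wordA/fg_reduced. Qed.

Lemma fg_mul1 : left_id fg_one fg_mul.
Proof. by move=> x; apply/val_inj. Qed.

Lemma fg_mulr1 : right_id fg_one fg_mul.
Proof. by move=> x; apply/val_inj/mul_word0/fg_reduced. Qed.

Lemma fg_mulV : left_inverse fg_one fg_inv fg_mul.
Proof. by move=> x; apply/val_inj/mul_inv_word/fg_reduced. Qed.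

Lemma fg_mulrV : right_inverse fg_one fg_inv fg_mul.
Proof.
move=> x; rewrite -[X in fg_mul X _](_ : fg_inv (fg_inv x) = x) ?fg_mulV //.
by apply/val_inj/inv_wordK.
Qed.

HB.instance Definition _ :=
  isGroup.Build free_group fg_mulA fg_mul1 fg_mulr1 fg_mulV fg_mulrV.

Definition fg_gen (t : T) : free_group := @FreeGroup [:: (t, false)] isT.

End FreeGroup.

Lemma free_group_universal (T : choiceType) (G : groupType) (f : T -> G) :
  exists! phi : free_group T -> G,
    {morph phi : x y / x * y} /\ forall t, phi (fg_gen t) = f t.
Proof.
pose ev (a : T * bool) := if a.2 then (f a.1)^-1 else f a.1.
pose phi (w : seq (T * bool)) := \prod_(a <- w) ev a.
have evV a : ev (letter_inv a) = (ev a)^-1.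
  by case: a => t [] //=; rewrite /ev /= invgK.
have phiC a w : phi (cons_reduce a w) = ev a * phi w.
  rewrite /phi; case: w => [|b w] /=; first by rewrite big_cons.
  by case: eqVneq => [->|_]; rewrite !big_cons // evV mulVKg.
have phiM u v : phi (mul_word u v) = phi u * phi v.
  elim: u => [|a u IH] /=; first by rewrite /phi big_nil mul1g.
  by rewrite phiC IH mulgA /phi big_cons.
exists (fun x : free_group T => phi x); split.
  by split=> [x y|t]; [exact: phiM | rewrite /phi /= big_seq1].
move=> psi [psiM psi_gen]; apply/funext => x.
have psi1 : psi 1 = 1.
  by apply: (mulgI (psi 1)); rewrite -psiM !mulg1.
have psiV y : psi y^-1 = (psi y)^-1.
  by apply: (mulgI (psi y)); rewrite -psiM !mulgV psi1.
case: x => w; elim: w => [|a w IH] rw.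
  by rewrite /phi big_nil -psi1; congr psi; apply: val_inj.
have rw' := path_sorted rw.
have -> : FreeGroup rw = @FreeGroup _ [:: a] isT * FreeGroup rw'.
  apply: val_inj => /=.
  by case: (w) rw => [//|b w'] /= /andP[/negPf ->].
rewrite psiM -(IH rw') [LHS]phiM; congr (_ * _); rewrite /phi /= big_seq1.
case: a {rw} => t [] /=; rewrite /ev /= -psi_gen -?psiV.
  by congr psi; apply: val_inj.
by congr psi; apply: val_inj.
Qed.

(* Main.v *)
Require Import Defs.
From HB Require Import structures.
From mathcomp Require Import all_boot all_order all_algebra.
From mathcomp Require Import boolp classical_sets functions cardinality.
From mathcomp Require Import fingroup perm zify.

(** Write F for the free group, w for a word, and z for a generator of the
central factor Z of F x Z.  A positive cone is the same thing as a
left-invariant total order on F x Z, x being below y when x^-1 y lies in the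
cone.

Why a finitely generated cone forces even rank.  Multiplying on the right by a
fixed element changes the first letter of a reduced word only near the identity
([first_letter_mul_eval]).  A product of generators is an increasing path, so
if the cone is generated by finitely many elements, any two comparable elements
with different first letters are separated in the order by a lift of one of
finitely many elements of F.  If z were not cofinal, it would follow that all
sufficiently large elements have the same first letter, which left
multiplication by two different generators refutes ([centre_cofinal]).  Hence,
with z positive, the cone is described by the integer function phi f, the least
m such that (f, m) is at least the identity ([height_exists]), and the smallest
generator is a least positive element (w, phi w) ([least_positive_exists]).

Modulo z the group F is now cyclically ordered, and x |-> x w is the successor
map.  The elements with a given first letter form finitely many arcs, and a new
arc can only begin between p and p w where p^-1 is a prefix of w
([cut_between]).  There are |w| + 1 such cuts.  Two cyclic permutations act on
them: rho passes to the next prefix of w (it translates the cut by the inverse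
of the letter of its arc), sigma passes to the next cut in the cyclic order.
They are conjugate, so tau = sigma^-1 rho is even.  On the other hand tau
exchanges arcs of a letter a with arcs of a^-1, and its square moves every arc
to the preceding arc of the same letter ([arc_pairing_prev]).  So tau has one
cycle for each generator, plus one fixed point for the arc reduced to the
identity, and |w| is even.  The sign of a permutation of |w| + 1 points with
n + 1 cycles is even exactly when |w| and n have the same parity, so n is even
([rank_even_of_least_positive]).  The picture behind this is a surface with a
single boundary circle and fundamental group F, w running along the boundary.

Why even rank suffices.  Conversely, for even n the surface exists: place the
2n letters around a vertex in the pattern x, y, x^-1, y^-1, repeated n / 2
times.  For any linear arrangement pos of the letters, the number of inverse
letters of a word minus the number of its turns a b with pos a^-1 < pos b is a
height function ([winding_height]), and so defines a cone
([height_cone_positive]).  A long word is a product of shorter ones of the same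
total height: cut it where there is no turn, or insert d d^-1 at a turn a b
with a letter d strictly between a^-1 and b.  If neither is possible inside the
word, the word follows the boundary of the surface, and for the above
arrangement this lasts for at most 2n letters ([word_lift_span]). *)

Set Implicit Arguments.
Unset Strict Implicit.
Unset Printing Implicit Defensive.
Import Order.TTheory GRing.Theory Num.Theory.
Local Open Scope group_scope.
Bind Scope group_scope with free_group.

(** * First letters in a free group *)

Section Words.
Variable T : choiceType.
Implicit Types (a b : T * bool) (s t : seq (T * bool)) (u f g : free_group T).

Definition letter a : free_group T := @FreeGroup T [:: a] isT.

Definition eval_word s : free_group T := \prod_(a <- s) letter a.

Definition first_letter u : option (T * bool) := ohead u.

Lemma fg_word_mul f g : fg_word (f * g) = mul_word f g. Proof. by []. Qed.

Lemma fg_word_letterM a f : fg_word (letter a * f) = cons_reduce a f.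
Proof. by []. Qed.

Lemma letterV a : letter (letter_inv a) = (letter a)^-1.
Proof. exact: val_inj. Qed.

Lemma eval_word_cons a s : eval_word (a :: s) = letter a * eval_word s.
Proof. by rewrite /eval_word big_cons. Qed.

Lemma eval_word_cat s t : eval_word (s ++ t) = eval_word s * eval_word t.
Proof. by rewrite /eval_word big_cat. Qed.

Lemma eval_word_reduced s : reduced s -> fg_word (eval_word s) = s.
Proof.
elim: s => [|a s IH] rs; first by rewrite /eval_word big_nil.
rewrite eval_word_cons fg_word_letterM (IH (path_sorted rs)).
by case: s rs {IH} => [//|b s] /= /andP[/negPf ->].
Qed.

Lemma fg_wordK f : eval_word f = f.
Proof. by apply/val_inj/eval_word_reduced/fg_reduced. Qed.

(** Left translation by a maps the complement of the words beginning with a^-1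
onto the words beginning with a. *)
Lemma first_letterM a u :
  (first_letter (letter a * u) == Some a) = (first_letter u != Some (letter_inv a)).
Proof.
rewrite /first_letter fg_word_letterM; case: u => [[|b u] ru] /=; first by apply/eqP.
rewrite [RHS](_ : _ = (b != letter_inv a)) //.
case: (eqVneq b) => [eb|_] /=; last exact: eqxx.
by case: u ru => [//|c u] /= /andP[+ _]; rewrite eb letter_invK => /negPf.
Qed.

(** In the Cayley tree, u and u b are the ends of an edge, and only the edges at
the identity join elements with different first letters. *)
Lemma first_letter_mul_letter u b :
  u != 1 -> u * letter b != 1 -> first_letter (u * letter b) = first_letter u.
Proof.
move=> u1 ub1; have: mul_word u [:: b] != [::] by apply: contra ub1 => /eqP e; apply/eqP/val_inj.
have: fg_word u != [::] by apply: contra u1 => /eqP e; apply/eqP/val_inj.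
rewrite /first_letter fg_word_mul /= {u1 ub1}; case: u => /=.
elim=> [//|a u IH] rau _; case: u rau IH => [|c u] rau IH /=.
  by case: ifP.
move: rau => /= /andP[ca ru]; move: (IH ru isT) => /=.
case: (cons_reduce c _) => [//|d v] /(_ isT) [->] _ /=.
by rewrite (negPf ca).
Qed.

(** The path in the Cayley tree from u along the letters of s has to pass through
the identity. *)
Lemma first_letter_mul_eval u s :
    first_letter (u * eval_word s) <> first_letter u ->
  exists2 k, (k <= size s)%N & u * eval_word (take k s) = 1.
Proof.
elim: s u => [|b s IH] u; first by rewrite /eval_word big_nil mulg1.
rewrite eval_word_cons mulgA => neq.
have [-> | u1] := eqVneq u 1; first by exists 0%N; rewrite // take0 /eval_word big_nil mulg1.
have [ub1 | ub1] := eqVneq (u * letter b) 1.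
  by exists 1%N => //=; rewrite take0 eval_word_cons /eval_word big_nil mulg1.
rewrite -(first_letter_mul_letter u1 ub1) in neq.
by have [k ks e] := IH _ neq; exists k.+1 => //=; rewrite eval_word_cons mulgA.
Qed.

End Words.

(** * Height functions and the ordered set they define *)

Lemma seq_max (X : eqType) (r : rel X) (s : seq X) (x0 : X) :
  total r -> transitive r -> x0 \in s ->
  exists2 x, x \in s & {in s, forall y, r y x}.
Proof.
move=> tot tr; elim: s x0 => // x s IH x0 _.
case: s IH => [|y s] IH.
  by exists x; rewrite ?mem_head // => z; rewrite inE => /eqP ->; case/orP: (tot x x).
have [q qs qmax] := IH y (mem_head _ _).
case/orP: (tot x q) => [xq|qx].
  exists q; first by rewrite inE qs orbT.
  by move=> z; rewrite inE => /predU1P[->//|]; apply: qmax.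
exists x; first exact: mem_head.
move=> z; rewrite inE => /predU1P[->|/qmax zq]; first by case/orP: (tot x x).
exact: tr zq qx.
Qed.

(** Different ways of finding the group structure of the same type yield
convertible but syntactically different arguments of phi, which [lia] would
treat as unrelated; they are identified first. *)
Ltac height_lia phi :=
  repeat match goal with H : context [phi] |- _ =>
    lazymatch type of H with is_true _ => move: H | @eq int _ _ => move: H end end;
  repeat match goal with |- context [phi ?t1] =>
    match goal with |- context [phi ?t2] =>
      tryif constr_eq t1 t2 then fail else
        (let e := constr:(erefl _ : t1 = t2) in change (phi t2) with (phi t1))
    end end;
  lia.

Section LiftedOrder.
Variables (G : groupType) (phi : G -> int).

(** Such a phi is the lower boundary of a positive cone of G x Z whose central
factor is cofinal: phi f is the least m with (f, m) at least 1.  Subadditivity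
is closure under products; the last clause says that, for f != 1, exactly one of
(f, m) and its inverse (f^-1, - m) is positive. *)
Definition height_function :=
  [/\ phi 1 = 0%R,
      forall f g, (phi (f * g) <= phi f + phi g)%R
    & forall f, f != 1 -> (phi f^-1 = 1 - phi f)%R].

Hypothesis phiP : height_function.
Lemma phi1 : phi 1 = 0%R. Proof. by case: phiP. Qed.
Lemma phiM f g : (phi (f * g) <= phi f + phi g)%R. Proof. by case: phiP. Qed.
Lemma phiV f : f != 1 -> (phi f^-1 = 1 - phi f)%R. Proof. by case: phiP => _ _; apply. Qed.

Implicit Types (x y p q : G * int) (f g u : G).

(** The order of the cone, x^-1 y being nonnegative; the centre acts by shifting the
second component. *)
Definition ple x y : bool := (phi (x.1^-1 * y.1) <= y.2 - x.2)%R.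
Definition plt x y : bool := ~~ ple y x.
Definition translate g (c : int) x : G * int := (g * x.1, (x.2 + c)%R).

Lemma ple_refl x : ple x x.
Proof. by rewrite /ple mulVg phi1 subrr. Qed.

Lemma ple_trans y x z : ple x y -> ple y z -> ple x z.
Proof.
rewrite /ple => xy yz; have := phiM (x.1^-1 * y.1) (y.1^-1 * z.1).
rewrite mulgA mulgK; height_lia phi.
Qed.

Lemma phi_flip f g : f != g -> (phi (f^-1 * g) = 1 - phi (g^-1 * f))%R.
Proof.
move=> fg; rewrite -phiV; last by rewrite mulg_eq1 eqg_inv eq_sym.
by rewrite invgM invgK.
Qed.

Lemma ple_total : total ple.
Proof.
move=> x y; rewrite /ple; have [->|/phi_flip ->] := eqVneq x.1 y.1; last height_lia phi.
by rewrite mulVg phi1; height_lia phi.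
Qed.

Lemma ple_anti x y : ple x y -> ple y x -> x = y.
Proof.
case: x y => [f m] [g k]; rewrite /ple /=.
have [->|/phi_flip ->] := eqVneq f g; last height_lia phi.
rewrite mulVg phi1 => mk km; congr pair; height_lia phi.
Qed.

Lemma pltW x y : plt x y -> ple x y.
Proof. by rewrite /plt; case/orP: (ple_total x y) => ->. Qed.

Lemma plt_le_trans y x z : plt x y -> ple y z -> plt x z.
Proof. by move=> xy yz; apply: contra xy; apply: ple_trans. Qed.

Lemma plt_neq x y : ple x y -> x <> y -> plt x y.
Proof. by move=> xy neq; apply/negP => yx; apply/neq/ple_anti. Qed.

Lemma pltNge x y : ple x y = ~~ plt y x. Proof. by rewrite /plt negbK. Qed.

Lemma ple_translate g c x y : ple (translate g c x) (translate g c y) = ple x y.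
Proof.
rewrite /ple /translate /= invgM mulgA mulgVK; congr (_ <= _)%R; height_lia phi.
Qed.

Lemma plt_translate g c x y : plt (translate g c x) (translate g c y) = plt x y.
Proof. by rewrite /plt ple_translate. Qed.

Lemma translate_shift g m c : translate 1 c (g, m) = (g, (m + c)%R).
Proof. by rewrite /translate /= mul1g. Qed.

Definition height_sum (s : seq G) : int := (\sum_(f <- s) phi f)%R.

Lemma height_sum_cons f s : height_sum (f :: s) = (phi f + height_sum s)%R.
Proof. by rewrite /height_sum big_cons. Qed.

Lemma phi_prod (s : seq G) : (phi (\prod_(f <- s) f) <= height_sum s)%R.
Proof.
elim: s => [|f s IH]; first by rewrite big_nil phi1 /height_sum big_nil.
by rewrite big_cons height_sum_cons; have := phiM f (\prod_(f <- s) f); height_lia phi.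
Qed.

(** The partial products of s form an increasing path from x, and the crossing
step is the one at which the path leaves V. *)
Lemma crossing_step (S : seq G) (V : pred G) (s : seq G) x :
    {subset s <= S} -> V x.1 -> ~~ V (x.1 * \prod_(f <- s) f) ->
  exists u : G * int, exists2 t, t \in S &
    [/\ ple x u, ple u (x.1 * \prod_(f <- s) f, (x.2 + height_sum s)%R),
        V u.1 & ~~ V (u.1 * t)].
Proof.
elim: s x => [|t s IH] x sS Vx; first by rewrite big_nil mulg1 Vx.
rewrite big_cons height_sum_cons mulgA => Vy.
have tS : t \in S by apply: sS; rewrite mem_head.
have sS' : {subset s <= S} by move=> z zs; apply: sS; rewrite inE zs orbT.
have [Vxt|Vxt] := boolP (V (x.1 * t)).
  have [u [t' t'S [xu uy Vu Vut]]] := IH (x.1 * t, (x.2 + phi t)%R) sS' Vxt Vy.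
  exists u, t' => //; split=> //.
    by apply: ple_trans xu; rewrite /ple /= mulKg; height_lia phi.
  by rewrite -addrA in uy.
exists x, t => //; split=> //; first exact: ple_refl.
rewrite /ple /= -mulgA mulKg.
by have := phi_prod (t :: s); rewrite big_cons height_sum_cons; height_lia phi.
Qed.

(** The cone is generated by (1, 1) and the elements (t, phi t), t in S.  By
subadditivity a product of the (t, phi t) never lies below the boundary of the
cone; here it has to lie on it. *)
Definition generates (S : seq G) :=
  forall f, f != 1 -> exists s, [/\ {subset s <= S}, f = \prod_(t <- s) t
                                  & phi f = height_sum s].

Lemma crossing (S : seq G) (V : pred G) x y :
    generates S -> ple x y -> V x.1 -> ~~ V y.1 ->
  exists u : G * int, exists2 t, t \in S &
    [/\ ple x u, ple u y, V u.1 & ~~ V (u.1 * t)].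
Proof.
move=> gS xy Vx Vy.
have neq : x.1^-1 * y.1 != 1.
  by apply: contraNneq Vy => /mulg1_eq; rewrite invgK => <-.
have [s [sS es ps]] := gS _ neq.
have ey : y.1 = x.1 * \prod_(t <- s) t by rewrite -es mulVKg.
rewrite ey in Vy; have [u [t tS [xu uy Vu Vut]]] := crossing_step sS Vx Vy.
exists u, t => //; split=> //; apply: ple_trans uy _.
by move: xy; rewrite /ple /= -ey mulVg phi1 ps; height_lia phi.
Qed.

(** (w, phi w) is the least element greater than 1: the equation says that
(w, phi w)^-1 (f, phi f) is again nonnegative, the other inequality being
subadditivity. *)
Definition least_positive w :=
  w != 1 /\ forall f, f != 1 -> (phi (w^-1 * f) = phi f - phi w)%R.

(** Every positive element is a product beginning with some generator, so it is
not smaller than that generator, and the smallest generator is least. *)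
Lemma least_positive_exists (S : seq G) f0 :
  f0 != 1 -> 1 \notin S -> generates S -> exists w, least_positive w.
Proof.
move=> f01 S1 gS.
have [t0 t0S] : exists t, t \in S.
  have [[|t s] [sS es _]] := gS _ f01; first by rewrite es big_nil eqxx in f01.
  by exists t; apply: sS; rewrite mem_head.
pose r t t' := ple (t', phi t') (t, phi t).
have [w wS wmin] : exists2 w, w \in S & {in S, forall t, r t w}.
  apply: (@seq_max _ r S t0) => //; first by move=> a b; apply: ple_total.
  by move=> b a c ab bc; apply: ple_trans bc ab.
exists w; split; first by apply: contraNneq S1 => <-.
move=> f f1; have [[|t s] [sS ef pf]] := gS f f1.
  by rewrite ef big_nil eqxx in f1.
have := wmin t (sS _ (mem_head _ _)); rewrite /r /ple /=.
have := phiM w (w^-1 * f); rewrite mulVKg.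
rewrite height_sum_cons in pf; rewrite big_cons in ef.
have := phiM (w^-1 * t) (\prod_(f <- s) f); rewrite -mulgA -ef.
by have := phi_prod s; height_lia phi.
Qed.

End LiftedOrder.

(** * Cuts *)

Section Cuts.
Variables (T : choiceType) (phi : free_group T -> int) (S : seq (free_group T)).
Variable w : free_group T.
Hypotheses (phiP : height_function phi) (gS : generates phi S).
Hypothesis wP : least_positive phi w.

Local Notation F := (free_group T).
Local Notation L := (size (fg_word w)).
Local Notation "x <=p y" := (ple phi x y) (at level 70).
Local Notation "x <p y" := (plt phi x y) (at level 70).
Implicit Types (x y p q : F * int).

Lemma phi_w f : f != 1 -> (phi (w^-1 * f) = phi f - phi w)%R.
Proof. by case: wP => _; apply. Qed.

Lemma w_neq1 : w != 1. Proof. by case: wP. Qed.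

Lemma phi_wV : (phi w^-1 = 1 - phi w)%R.
Proof. exact: phiV phiP _ w_neq1. Qed.

(** As (w, phi w) is the least positive element, left invariance makes right
multiplication by it the successor map of the order. *)
Definition successor x : F * int := (x.1 * w, (x.2 + phi w)%R).

Lemma successor_le x y : x <p y -> successor x <=p y.
Proof.
case: x y => f m [g k]; rewrite /plt /ple /successor /= invgM -mulgA.
have [->|fg] := eqVneq f g; first by rewrite !mulVg (phi1 phiP) mulg1 phi_wV; lia.
rewrite phi_w; last by rewrite mulg_eq1 eqg_inv.
by rewrite (phi_flip phiP fg); height_lia phi.
Qed.

Lemma successor_gt x : x <p successor x.
Proof.
rewrite /plt /ple /= invgM mulgVK phi_wV; lia.
Qed.

(** These are the elements p for which the tree path from p to its successor p w
passes through 1. *)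
Definition cut_point (k : nat) : F := (eval_word (take k w))^-1.

(** A path with steps in S can change first letter only when it leaves one of
these elements. *)
Definition crossing_points : seq F :=
  [seq (eval_word (take k (fg_word s)))^-1 | s <- S, k <- iota 0 (size (fg_word s)).+1].

Lemma crossing_pointsP u s : s \in S ->
  first_letter (u * s) <> first_letter u -> u \in crossing_points.
Proof.
move=> sS; rewrite -{1}(fg_wordK s) => /first_letter_mul_eval[k ks /eqP].
rewrite mulg_eq1 => /eqP->; apply/allpairsPdep; exists s, k; split=> //.
by rewrite mem_iota /= add0n ltnS.
Qed.

(** Take the largest element q that lies between x and y, has the first letter of
x, and is x or a lift of a crossing point; there are only finitely many
candidates.  If the successor of q still had the same first letter, then the path
from there to y would leave this letter at a crossing point larger than q.  So q
is followed by an element with another first letter.  This finiteness is what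
rules out arcs that end at a gap without a last element. *)
Lemma cut_between x y : x <=p y -> first_letter x.1 <> first_letter y.1 ->
  exists k m, [/\ (k <= L)%N, first_letter (cut_point k) = first_letter x.1,
                  x <=p (cut_point k, m) & successor (cut_point k, m) <=p y].
Proof.
move=> xy neq; pose V (f : F) := first_letter f == first_letter x.1.
have Vx : V x.1 by apply/eqP.
have Vy : ~~ V y.1 by apply/eqP => e; apply: neq.
(* For given u, the m with x <= (u, m) <= y form an interval of at most span u
   integers, starting at x.2 + phi (x.1^-1 u). *)
pose span u := (absz (y.2 - phi (u^-1 * y.1) - x.2 - phi (x.1^-1 * u))%R).+1.
pose l := x :: [seq p <- [seq (u, (x.2 + phi (x.1^-1 * u) + i%:Z)%R)
                         | u <- crossing_points, i <- iota 0 (span u)]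
               | V p.1 && (x <=p p) && (p <=p y)].
have lP u (m : int) : u \in crossing_points -> V u -> x <=p (u, m) -> (u, m) <=p y ->
    (u, m) \in l.
  move=> uc Vu xu uy; rewrite inE mem_filter [V _]Vu xu uy; apply/orP; right.
  apply/allpairsPdep; exists u, (absz (m - x.2 - phi (x.1^-1 * u))%R).
  rewrite /ple /= in xu uy; split=> //.
    by rewrite mem_iota /span; height_lia phi.
  by congr pair; height_lia phi.
have [q ql qmax] : exists2 q, q \in l & {in l, forall p, p <=p q}.
  apply: (@seq_max _ (ple phi) l x); last exact: mem_head.
    exact: ple_total.
  by move=> b a c; apply: ple_trans.
have [Vq xq qy] : [/\ V q.1, x <=p q & q <=p y].
  move: ql; rewrite inE mem_filter => /predU1P[->|/andP[/andP[/andP[-> ->] ->] _]] //.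
  by rewrite Vx xy ple_refl.
have nqy : successor q <=p y.
  by apply/successor_le/plt_neq => // e; rewrite -e Vq in Vy.
have [Vnq|Vnq] := boolP (V (successor q).1).
  have [[u m] [s sS [/= qu uy Vu Vus]]] := crossing phiP gS nqy Vnq Vy.
  have uc : u \in crossing_points.
    apply: crossing_pointsP sS _ => e.
    by move: Vus Vu; rewrite /V e => /negP.
  have xu : x <=p (u, m).
    by apply: ple_trans qu => //; apply: ple_trans xq _ => //; apply/pltW/successor_gt.
  have := successor_gt q; rewrite /plt.
  by rewrite (ple_trans phiP qu (qmax _ (lP _ _ uc Vu xu uy))).
have /first_letter_mul_eval[k kL /eqP] :
    first_letter (q.1 * eval_word w) <> first_letter q.1.
  rewrite fg_wordK => e; case/negP: Vnq; rewrite /V /= e; exact: Vq.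
rewrite mulg_eq1 => /eqP e; exists k, q.2; rewrite /cut_point -e -surjective_pairing.
by split=> //; apply/eqP.
Qed.

End Cuts.

(** * The pairing of arcs and the parity of the rank *)

Section Parity.
Variables (T : finType) (phi : free_group T -> int) (S : seq (free_group T)).
Variables (w : free_group T) (a0 : T * bool).
Hypotheses (phiP : height_function phi) (gS : generates phi S).
Hypothesis wP : least_positive phi w.

Local Notation F := (free_group T).
Local Notation L := (size (fg_word w)).
Local Notation "x <=p y" := (ple phi x y) (at level 70).
Local Notation "x <p y" := (plt phi x y) (at level 70).
Local Notation P := (cut_point w).
Local Notation successor := (successor phi w).
Implicit Types (x y p q : F * int) (i j k l : 'I_L.+1).

(** The default letter a0 is never reached for i < L; at i = L the element P i w
is 1, which has no first letter. *)
Definition letter_at (i : nat) : T * bool := nth a0 w i.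

Lemma cut_point_word (k : nat) : fg_word (P k) = inv_word (take k w).
Proof.
have rk : reduced (take k w) by apply: take_sorted; apply: fg_reduced.
by rewrite -[in RHS](eval_word_reduced rk).
Qed.

Lemma cut_point0 : P 0 = 1.
Proof. by rewrite /cut_point take0 /eval_word big_nil invg1. Qed.

Lemma cut_pointL : P L = w^-1.
Proof. by rewrite /cut_point take_size fg_wordK. Qed.

(** Translating a cut by the inverse of the letter on its upper side gives the cut
of the next prefix. *)
Lemma cut_pointS (k : nat) : (k < L)%N -> P k.+1 = (letter (letter_at k))^-1 * P k.
Proof.
move=> kL; rewrite /cut_point (take_nth a0) // -cats1 eval_word_cat invgM.
by rewrite eval_word_cons /eval_word big_nil mulg1.
Qed.

Lemma cut_point_inj (k l : nat) : (k <= L)%N -> (l <= L)%N -> P k = P l -> k = l.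
Proof.
move=> kL lL e; have : size (fg_word (P k)) = size (fg_word (P l)) by rewrite e.
by rewrite !cut_point_word /inv_word !size_rev !size_map !size_takel.
Qed.

Lemma first_letter_cutS (k : nat) : (k < L)%N ->
  first_letter (P k.+1) = Some (letter_inv (letter_at k)).
Proof.
move=> kL; rewrite /first_letter cut_point_word (take_nth a0) //.
by rewrite /inv_word map_rcons rev_rcons.
Qed.

Lemma cut_pointMw (k : nat) : P k * w = eval_word (drop k w).
Proof.
have -> : P k * w = P k * eval_word (take k w ++ drop k w).
  by rewrite cat_take_drop fg_wordK.
by rewrite eval_word_cat mulKg.
Qed.

Lemma first_letter_next (k : nat) : (k < L)%N ->
  first_letter (P k * w) = Some (letter_at k).
Proof.
move=> kL; rewrite cut_pointMw /first_letter eval_word_reduced; last first.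
  by apply: drop_sorted; apply: fg_reduced.
by rewrite (drop_nth a0).
Qed.

(** The lift of a cut to the fundamental domain of the centre, which consists of
the elements from 1 = hat 0 to (w^-1, phi w^-1) = hat L, the predecessor of the
central element (1, 1). *)
Definition hat (k : nat) : F * int := (P k, phi (P k)).

Lemma hat0 : hat 0 = (1, 0%R).
Proof. by rewrite /hat cut_point0 (phi1 phiP). Qed.

Lemma hat_ge0 (k : nat) : hat 0 <=p hat k.
Proof. by rewrite hat0 /ple /hat /= invg1 mul1g subr0. Qed.

Lemma le_hatL x : (x <=p hat L) = (x.2 <= phi x.1)%R.
Proof.
have e : (phi (w * x.1)^-1 = 1 - phi w - phi x.1)%R.
  have [wx1|wx1] := eqVneq (w * x.1) 1.
    by rewrite -(mulg1_eq wx1) (phi_wV phiP wP) mulgV invg1 (phi1 phiP); lia.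
  by rewrite (phiV phiP wx1); have := phi_w wP wx1; rewrite mulKg; height_lia phi.
by rewrite /hat cut_pointL /ple /= -invgM e (phi_wV phiP wP); lia.
Qed.

Lemma hat_le_max (k : nat) : hat k <=p hat L.
Proof. by rewrite le_hatL. Qed.

Lemma hat_fundamental_domain x : hat 0 <=p x -> x <=p hat L -> x = (x.1, phi x.1).
Proof.
rewrite hat0 le_hatL; case: x => f m.
by rewrite /ple /= invg1 mul1g subr0 => ? ?; congr pair; lia.
Qed.

Lemma hat_inj (k l : nat) : (k <= L)%N -> (l <= L)%N -> hat k = hat l -> k = l.
Proof. by move=> kL lL /(congr1 fst); apply: cut_point_inj. Qed.

Definition hat_le (i j : 'I_L.+1) : bool := hat i <=p hat j.

Definition sorted_cuts : seq 'I_L.+1 := sort hat_le (enum 'I_L.+1).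

Lemma size_sorted_cuts : size sorted_cuts = L.+1.
Proof. by rewrite size_sort size_enum_ord. Qed.

Lemma hat_le_trans : transitive hat_le.
Proof. by move=> j i k; apply: ple_trans. Qed.

Lemma rank_fun_inj : injective (fun i : 'I_L.+1 => nth ord0 sorted_cuts i).
Proof.
move=> i j /eqP; rewrite nth_uniq ?size_sorted_cuts //; first by move/eqP/val_inj.
by rewrite sort_uniq enum_uniq.
Qed.

Definition nth_cut : {perm 'I_L.+1} := perm rank_fun_inj.

Lemma nth_cut_le i j : (hat (nth_cut i) <=p hat (nth_cut j)) = (i <= j)%N.
Proof.
have mono i' j' : (i' <= j')%N -> hat (nth_cut i') <=p hat (nth_cut j').
  move=> ij; rewrite !permE; apply: (sorted_leq_nth hat_le_trans) => //.
  - by move=> k; apply: ple_refl.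
  - by apply: sort_sorted => k l; apply: ple_total.
  - by rewrite inE size_sorted_cuts.
  - by rewrite inE size_sorted_cuts.
have [/mono//|ji] := leqP i j; apply/negP => ij.
have /hat_inj e : hat (nth_cut i) = hat (nth_cut j).
  exact: (ple_anti phiP) ij (mono _ _ (ltnW ji)).
have /perm_inj eij : nth_cut i = nth_cut j.
  by apply/val_inj/e; rewrite -ltnS.
by rewrite eij ltnn in ji.
Qed.

Lemma nth_cut0 : nth_cut ord0 = ord0.
Proof.
apply/val_inj/hat_inj; rewrite ?leq_ord // ; apply: (ple_anti phiP); last exact: hat_ge0.
by have := nth_cut_le ord0 (nth_cut^-1 ord0); rewrite permKV leq0n.
Qed.

Lemma nth_cutL : nth_cut ord_max = ord_max.
Proof.
apply/val_inj/hat_inj; rewrite ?leq_ord //; apply: (ple_anti phiP); first exact: hat_le_max.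
have := nth_cut_le (nth_cut^-1 ord_max) ord_max; rewrite permKV leq_ord.
by [].
Qed.

(** The order of the cuts along the word w.  The last cut, between w^-1 and 1, is
followed by the first one, between 1 and w; up to a translation both are the same
place on the boundary. *)
Definition boundary_shift : {perm 'I_L.+1} := perm (@ordS_inj L.+1).

(** The order of the cuts in the cyclic order of F: the enumeration [nth_cut]
conjugates it to the cyclic shift of the positions, which happens to be the same
permutation of indices as [boundary_shift]. *)
Definition cyclic_next : {perm 'I_L.+1} := nth_cut^-1 * boundary_shift * nth_cut.

(** The arc of cut i consists of the elements after this cut, up to the next cut.
For i < L the translation by the inverse of letter_at i carries its lower end to
cut i + 1, and the arc of tau i is the one that ends there. *)
Definition arc_pairing : {perm 'I_L.+1} := boundary_shift * cyclic_next^-1.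

Local Notation rho := boundary_shift.
Local Notation tau := arc_pairing.

Lemma cyclic_nextE i : cyclic_next (nth_cut i) = nth_cut (rho i).
Proof. by rewrite !permM permK. Qed.

(** It is the product of rho and the inverse of a conjugate of rho. *)
Lemma even_arc_pairing : odd_perm tau = false.
Proof.
rewrite odd_permM odd_permV /cyclic_next !odd_permM odd_permV.
by case: (odd_perm nth_cut); case: (odd_perm rho).
Qed.

Lemma arc_pairing_next i : cyclic_next (tau i) = rho i.
Proof.
have -> : tau i = cyclic_next^-1 (rho i) by rewrite permM.
by rewrite permKV.
Qed.

Lemma shift_lt i : (i < L)%N -> rho i = i.+1 :> nat.
Proof. by move=> iL; rewrite permE /= modn_small. Qed.

Lemma shift_max : rho ord_max = ord0.
Proof. by apply/val_inj; rewrite permE /= modnn. Qed.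

Lemma arc_pairing_max : tau ord_max = ord_max.
Proof.
apply: (@perm_inj _ cyclic_next); rewrite arc_pairing_next shift_max.
by rewrite -{1}nth_cutL cyclic_nextE shift_max nth_cut0.
Qed.

Lemma neq_max_lt i : (i != ord_max) = (i < L)%N.
Proof. by rewrite ltn_neqAle leq_ord andbT. Qed.

Lemma arc_pairing_lt i : (i < L)%N -> (tau i < L)%N.
Proof.
rewrite -!neq_max_lt; apply: contraNneq => e.
by apply/eqP/(@perm_inj _ tau); rewrite e arc_pairing_max.
Qed.

Lemma arc_pairing_consecutive i : (i < L)%N ->
  hat (tau i) <p hat i.+1 /\
  forall k, hat (tau i) <p hat k -> ~ hat k <p hat i.+1.
Proof.
move=> iL; pose r := nth_cut^-1 (tau i).
have er : tau i = nth_cut r by rewrite permKV.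
have en : rho i = nth_cut (rho r) by rewrite -cyclic_nextE -er arc_pairing_next.
have rL : (r < L)%N.
  rewrite -neq_max_lt; apply: contraTneq iL => rmax.
  move: en; rewrite rmax shift_max nth_cut0 => /(congr1 val) /=.
  by rewrite permE /= => /eqP; rewrite -/(dvdn _ _) => /dvdn_leq; lia.
rewrite -(shift_lt iL) en er; split; first by rewrite /plt nth_cut_le (shift_lt rL) ltnn.
move=> k; rewrite -[k](permKV nth_cut) /plt !nth_cut_le (shift_lt rL); lia.
Qed.

(** A change of first letter inside the arc would happen at another cut. *)
Lemma arc_letter i x : (i < L)%N -> hat (tau i) <p x -> x <=p hat i.+1 ->
  first_letter x.1 = Some (letter_inv (letter_at i)).
Proof.
move=> iL jx xi; rewrite -first_letter_cutS //.
have [//|/eqP neq] := eqVneq (first_letter x.1) (first_letter (P i.+1)).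
have [k [m [kL _ xk ki]]] := cut_between phiP gS wP xi neq.
have [_ cons] := arc_pairing_consecutive iL.
have ki' : (P k, m) <p hat i.+1 by apply: plt_le_trans ki => //; apply: successor_gt.
have ek : (P k, m) = hat k.
  apply: hat_fundamental_domain.
    by apply: ple_trans xk => //; apply: ple_trans (hat_ge0 (tau i)) _ => //; apply: pltW.
  by apply: ple_trans (hat_le_max i.+1) => //; apply: pltW.
rewrite ek in xk ki'.
case: (cons (inord k)); rewrite inordK //.
exact: plt_le_trans xk.
Qed.

Lemma arc_pairing_letter i : (i < L)%N ->
  letter_at (tau i) = letter_inv (letter_at i).
Proof.
move=> iL; have [ji _] := arc_pairing_consecutive iL.
have := arc_letter iL (successor_gt phiP wP (hat (tau i))) (successor_le phiP wP ji).
by rewrite first_letter_next ?arc_pairing_lt // => -[].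
Qed.

(** The stretch between the lower end of arc i and the end of the preceding arc of
the same letter a is the translate by a of the arc of tau i, all of whose
elements begin with a^-1; so it contains no element that begins with a.  Right
below it lies, by the same reasoning for tau i, an arc of the letter a, namely
that of tau (tau i). *)
Lemma arc_pairing_prev i l : (i < L)%N -> (l < L)%N -> letter_at l = letter_at i ->
  hat l <p hat i -> hat (tau (tau i)) <p hat i /\ hat l <=p hat (tau (tau i)).
Proof.
move=> iL lL eli li; set k := tau i; set j := tau k.
have kL : (k < L)%N by apply: arc_pairing_lt.
have jL : (j < L)%N by apply: arc_pairing_lt.
pose a := letter_at i.
have ek : letter_at k = letter_inv a by apply: arc_pairing_letter.
have [ki consk] := arc_pairing_consecutive iL; rewrite -/k in ki consk.
have [jk consj] := arc_pairing_consecutive kL; rewrite -/j in jk consj.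
pose c := (phi (P i) - phi (P i.+1))%R.
have ei : translate (letter a) c (hat i.+1) = hat i.
  have eP : letter a * P i.+1 = P i by rewrite cut_pointS // mulVKg.
  by rewrite /translate /= eP /c addrC subrK.
(* Q and R are the lifts of the cuts k + 1 and j for which R < Q < hat i are the
   ends of two adjacent stretches: the letter is a on (R, Q] and never a on
   (Q, hat i]. *)
pose Q := translate (letter a) c (hat k).
have Qi : Q <p hat i by rewrite -ei plt_translate.
have A1 x : Q <p x -> x <=p hat i -> first_letter x.1 <> Some a.
  move=> Qx xi; pose y := translate (letter a)^-1 (- c)%R x.
  have ex : x = translate (letter a) c y.
    by rewrite /y /translate /= mulVKg; case: (x) => f m /=; congr pair; lia.
  rewrite ex plt_translate in Qx; rewrite ex -ei ple_translate in xi.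
  have := arc_letter iL Qx xi; rewrite -/a => fy.
  by rewrite ex /= => /eqP; rewrite first_letterM fy eqxx.
have eQ1 : Q.1 = P k.+1 by rewrite cut_pointS // ek letterV invgK.
pose c2 := (Q.2 - phi (P k.+1))%R.
have eQ : translate 1 c2 (hat k.+1) = Q.
  by rewrite translate_shift [RHS]surjective_pairing eQ1 /c2 addrC subrK.
pose R := translate 1 c2 (hat j).
have RQ : R <p Q by rewrite -eQ plt_translate.
have fl : first_letter (successor (hat l)).1 = Some a by rewrite first_letter_next ?eli.
have nli : successor (hat l) <=p hat i by apply: successor_le.
have nlQ : successor (hat l) <=p Q.
  by rewrite pltNge; apply/negP => /A1/(_ nli).
have lQ : hat l <p Q by apply: plt_le_trans nlQ => //; apply: successor_gt.
have lR : hat l <=p R.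
  rewrite pltNge; apply/negP => Rl.
  pose q := translate 1 (- c2)%R (hat l).
  have eq : hat l = translate 1 c2 q by rewrite /q /translate /= !mul1g addrNK.
  rewrite eq plt_translate in Rl; rewrite eq -eQ plt_translate in lQ.
  have hq : q = hat l.
    have -> : hat l = (q.1, phi q.1) by rewrite /q /= mul1g.
    apply: hat_fundamental_domain.
      by apply: ple_trans (hat_ge0 j) _ => //; apply: pltW.
    by apply: ple_trans (hat_le_max k.+1) => //; apply: pltW.
  by rewrite hq in Rl lQ; apply: consj lQ.
have Ri : R <p hat i by apply: plt_le_trans RQ _ => //; apply: pltW.
suff -> : hat j = R by [].
have -> : hat j = (R.1, phi R.1) by rewrite /R /= mul1g.
apply/esym/hat_fundamental_domain; first by apply: ple_trans (hat_ge0 l) _.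
by apply: ple_trans (hat_le_max i) => //; apply: pltW.
Qed.

(** Descend from the larger to the smaller cut by applying tau twice at a time; by
[arc_pairing_prev] no cut with this letter is skipped. *)
Lemma same_letter_same_orbit i l : (i < L)%N -> (l < L)%N ->
  letter_at l = letter_at i -> l \in porbit tau i.
Proof.
wlog li : i l / hat l <=p hat i => [hw|].
  case/orP: (ple_total phiP (hat l) (hat i)) => li iL lL e; first exact: hw.
  by rewrite porbit_sym; apply: hw.
have [r ri] := ubnP (nth_cut^-1 i : nat).
elim: r i l li ri => // r IH i l li ri iL lL eli.
have [eli'|] := eqVneq l i; first by rewrite eli' porbit_id.
move=> neq; have lti : hat l <p hat i.
  apply: plt_neq li _ => // /hat_inj e; case/eqP: neq; apply/val_inj/e; rewrite -ltnS //.
have [ji lj] := arc_pairing_prev iL lL eli lti.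
have t2 : tau (tau i) \in porbit tau i.
  by rewrite -[tau (tau i)]/(tau (aperm i tau)) -permM -expg2 mem_porbit.
have jL := arc_pairing_lt (arc_pairing_lt iL).
have/eqP <- : porbit tau (tau (tau i)) == porbit tau i by rewrite eq_porbit_mem.
apply: IH lj _ jL lL _; last first.
  by rewrite eli !arc_pairing_letter ?arc_pairing_lt // letter_invK.
move: ri; rewrite ltnS; apply: leq_trans; rewrite ltnNge; apply: contra ji.
by rewrite -nth_cut_le !permKV.
Qed.

(** Elements beginning with the letter t are followed later by lifts of the
identity, so some cut separates t from another first letter. *)
Lemma every_generator_occurs (t : T) : exists2 k, (k < L)%N & (letter_at k).1 = t.
Proof.
pose x := (letter (t, false), phi (letter (t, false))).
have xy : x <=p (1, 1%R).
  rewrite /ple /x /= mulg1 (phiV phiP) //.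
have [|[|k] [m [kL fk _ _]]] := cut_between phiP gS wP xy _ => //.
  by rewrite cut_point0 in fk.
exists k => //; move: fk; rewrite first_letter_cutS //= => -[<-] //.
Qed.

(** The value None at L keeps apart the cut above which only the identity lies. *)
Definition generator_at i : option T := nth None [seq Some a.1 | a <- fg_word w] i.

Lemma generator_at_lt i : (i < L)%N -> generator_at i = Some (letter_at i).1.
Proof. by move=> iL; rewrite /generator_at (nth_map a0). Qed.

Lemma generator_at_max : generator_at ord_max = None.
Proof. by rewrite /generator_at nth_default // size_map. Qed.

(** The arcs of t and those of t^-1 belong to one cycle because tau exchanges the
two kinds. *)
Lemma generator_at_orbit i j :
  (j \in porbit tau i) = (generator_at j == generator_at i).
Proof.
apply/idP/eqP => [/porbitP[m ->]|].
  elim: m => [|m IH]; first by rewrite expg0 perm1.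
  rewrite expgSr permM -IH; set k := (tau ^+ m) i.
  have [->|] := eqVneq k ord_max; first by rewrite arc_pairing_max.
  rewrite neq_max_lt => kL.
  by rewrite !generator_at_lt ?arc_pairing_lt // arc_pairing_letter.
have [->|] := eqVneq i ord_max; have [->|] := eqVneq j ord_max.
- by rewrite porbit_id.
- by rewrite neq_max_lt => jL; rewrite generator_at_max generator_at_lt.
- by rewrite neq_max_lt => iL; rewrite generator_at_max generator_at_lt.
rewrite !neq_max_lt => jL iL; rewrite !generator_at_lt // => -[e].
have [eli|nli] := eqVneq (letter_at j) (letter_at i).
  exact: same_letter_same_orbit.
have {}nli : letter_at j = letter_at (tau i).
  rewrite arc_pairing_letter //; move: e nli; rewrite /letter_inv.
  case: (letter_at j) (letter_at i) => [t b] [t' b'] /= <-.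
  by case: b b' => [] [] //=; rewrite eqxx.
have/eqP <- : porbit tau (tau i) == porbit tau i.
  by rewrite eq_porbit_mem -{1}(expg1 tau) mem_porbit.
by apply: same_letter_same_orbit; rewrite // arc_pairing_lt.
Qed.

Lemma card_orbits : #|porbits tau| = #|T|.+1.
Proof.
rewrite -card_option.
have surj (x : option T) : exists i : 'I_L.+1, generator_at i = x.
  case: x => [t|]; last by exists ord_max; apply: generator_at_max.
  have [k kL <-] := every_generator_occurs t.
  have kL' : (k < L.+1)%N by rewrite ltnW.
  by exists (Ordinal kL'); rewrite generator_at_lt.
pose cls c := [set j : 'I_L.+1 | generator_at j == c].
have -> : porbits tau = cls @: [set: option T]%SET.
  apply/setP => A; apply/imsetP/imsetP => -[x _ ->].
    exists (generator_at x) => //.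
    by apply/setP => j; rewrite inE generator_at_orbit.
  have [i <-] := surj x.
  by exists i => //; apply/setP => j; rewrite inE generator_at_orbit.
rewrite card_imset ?cardsT // => c d /setP eqcd; have [i ic] := surj c.
by have := eqcd i; rewrite !inE ic eqxx => /esym/eqP.
Qed.

(** The injection tau exchanges the positions of w carrying a generator with those
carrying the inverse of a generator. *)
Lemma length_even : ~~ odd L.
Proof.
pose A b := [set i : 'I_L.+1 | (i < L)%N && ((letter_at i).2 == b)].
have sub b : (#|A b| <= #|A (~~ b)|)%N.
  rewrite -(card_imset _ (@perm_inj _ tau)); apply/subset_leq_card/fintype.subsetP => j.
  case/imsetP => i; rewrite !inE => /andP[iL /eqP <-] ->.
  by rewrite arc_pairing_lt // arc_pairing_letter //= eqxx.
have eA : #|A true| = #|A false| by apply/eqP; rewrite eqn_leq sub (sub false).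
have : #|[set: 'I_L.+1]| = (#|A true| + #|A false|).+1.
  rewrite (cardsD1 ord_max [set: _]%SET) finset.in_setT add1n; congr _.+1.
  rewrite -cardsUI (_ : A true :&: A false = finset.set0)%SET; last first.
    apply/setP => i; rewrite !inE; case: (letter_at i).2; rewrite ?andbF //.
  rewrite cards0 addn0; congr #|pred_of_set _|.
  apply/setP => i; rewrite !inE andbT neq_max_lt.
  by case: (i < L)%N => //=; case: (letter_at i).2.
rewrite cardsT card_ord eA addnn => -[->].
by rewrite odd_double.
Qed.

(** Compare the parity of tau with the number |T| + 1 of its cycles on |w| + 1
points. *)
Lemma rank_even_of_least_positive : ~~ odd #|T|.
Proof.
have := even_arc_pairing; rewrite /odd_perm card_ord card_orbits /=.
by rewrite (negPf length_even) /=; case: (odd #|T|).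
Qed.

End Parity.

(** * From a cone to a height function *)

Section Height.
Variables (T : choiceType) (Q : free_group T -> int -> Prop).
Local Notation F := (free_group T).
Implicit Types (f g h u : F) (k m : int).

Hypothesis QM : forall f g m k, Q f m -> Q g k -> Q (f * g) (m + k)%R.
Hypothesis Q0 : ~ Q 1 0%R.
Hypothesis Qtot : forall f m, (f, m) <> (1, 0%R) -> Q f m \/ Q f^-1 (- m)%R.
Hypothesis Qz : Q 1 1%R.

(** Q f m stands for membership of (f, m) in the cone, up to the sign chosen for
the central factor. *)
Definition nonneg f m := Q f m \/ (f = 1 /\ m = 0%R).

Lemma nonnegM f g m k : nonneg f m -> nonneg g k -> nonneg (f * g) (m + k)%R.
Proof.
case=> [qf|[-> ->]] [qg|[-> ->]]; rewrite ?mul1g ?mulg1 ?addr0 ?add0r.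
- by left; apply: QM.
- by left.
- by left.
- by right.
Qed.

Lemma nonneg_posM f g m k : nonneg f m -> Q g k -> Q (f * g) (m + k)%R.
Proof. by case=> [qf|[-> ->]] qg; [apply: QM | rewrite mul1g add0r]. Qed.

Lemma nonnegV f m : nonneg f m -> ~ Q f^-1 (- m)%R.
Proof. by move=> qf qfV; apply: Q0; rewrite -(mulgV f) -(subrr m); apply: nonneg_posM. Qed.

Lemma nonneg_or f m : nonneg f m \/ Q f^-1 (- m)%R.
Proof.
have [[-> ->]|/eqP /Qtot[]] := eqVneq (f, m) (1, 0%R); by [left; right|left; left|right].
Qed.

Section HeightOfCone.
Variable phi : F -> int.
Hypothesis phiQ : forall f k, nonneg f k <-> (phi f <= k)%R.

Lemma height_functionP : height_function phi.
Proof.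
have Qphi f : nonneg f (phi f) by apply/phiQ.
split.
- apply/eqP; rewrite eq_le; apply/andP; split; first by apply/phiQ; right.
  rewrite leNgt; apply/negP => lt0; have : nonneg 1 (- 1)%R by apply/phiQ; height_lia phi.
  by move/nonnegV; rewrite opprK invg1.
- by move=> f g; apply/phiQ/nonnegM.
move=> f f1; apply/eqP; rewrite eq_le; apply/andP; split.
  apply/phiQ; case: (nonneg_or f (phi f - 1)%R) => [/phiQ|q]; first by height_lia phi.
  by left; move: q; have -> : (- (phi f - 1) = 1 - phi f)%R by height_lia phi.
rewrite leNgt; apply/negP => lt1; have : nonneg f^-1 (- phi f)%R by apply/phiQ; height_lia phi.
case=> [/nonnegV-/(_ (Qphi f))//|[/eqP]]; rewrite invg_eq1 (negPf f1) //.
Qed.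

Variable S : seq (F * int).
Hypothesis QS : forall p, p \in S -> Q p.1 p.2.
Hypothesis Qgen : forall f m, Q f m -> exists s, [/\ {subset s <= S},
  f = \prod_(p <- s) p.1 & m = (\sum_(p <- s) p.2)%R].

(** A product of generators that lies on the boundary of the cone has all its
factors on the boundary, except that central factors may be dropped. *)
Lemma height_generates :
  generates phi [seq p.1 | p <- S & p.1 != 1].
Proof.
move=> f f1; have [q|[/eqP]] := (phiQ f (phi f)).2 (lexx _); last by rewrite (negPf f1).
have [s [sS ef ephi]] := Qgen q.
pose s' := [seq p.1 | p <- s & p.1 != 1].
have ef' : f = \prod_(t <- s') t.
  rewrite {1}ef /s'; elim: s {sS ef ephi s'} => [|p s IH]; first by rewrite !big_nil.
  rewrite big_cons /= IH; case: eqVneq => [->|_] /=; first by rewrite mul1g.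
  by rewrite big_cons.
have tot : (height_sum phi s' <= phi f)%R.
  rewrite ephi /s'; elim: s sS {ef ephi ef' s'} => [|p s IH] sS.
    by rewrite /height_sum !big_nil.
  have pS : (phi p.1 <= p.2)%R by apply/phiQ; left; apply: QS; apply: sS; rewrite mem_head.
  have {}IH := IH (fun z zs => sS z (@mem_behead _ (p :: s) z zs)).
  rewrite big_cons /=; case: eqVneq => [p1|_] /=; last by rewrite height_sum_cons lerD.
  by rewrite p1 (phi1 height_functionP) in pS; rewrite -[X in (X <= _)%R]add0r lerD.
exists s'; split=> //.
  move=> g /mapP[p]; rewrite mem_filter => /andP[p1 /sS ps] ->.
  by apply: map_f; rewrite mem_filter p1.
apply/eqP; rewrite eq_le tot andbT [in X in (X <= _)%R]ef'.
exact: (phi_prod height_functionP).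
Qed.

End HeightOfCone.

Variables (S : seq (F * int)) (t1 t2 : T).
Hypothesis QS : forall p, p \in S -> Q p.1 p.2.
Hypothesis Qgen : forall f m, Q f m -> exists s, [/\ {subset s <= S},
  f = \prod_(p <- s) p.1 & m = (\sum_(p <- s) p.2)%R].
Hypothesis t12 : t1 != t2.

(** The analogue of [crossing_step] before it is known that the cone comes from a
height function. *)
Lemma walk_crossing (V : pred F) (s : seq (F * int)) f :
    {subset s <= S} -> V f -> ~~ V (f * \prod_(p <- s) p.1) ->
  exists u k, [/\ nonneg (f^-1 * u) k, V u & exists2 p, p \in S & ~~ V (u * p.1)].
Proof.
elim: s f => [|p s IH] f sS Vf; first by rewrite big_nil mulg1 Vf.
rewrite big_cons mulgA => Vy.
have pS : p \in S by apply: sS; rewrite mem_head.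
have sS' : {subset s <= S} by move=> z zs; apply: sS; rewrite inE zs orbT.
have [Vfp|Vfp] := boolP (V (f * p.1)); last first.
  by exists f, 0%R; split=> //; [right; rewrite mulVg | exists p].
have [u [k [ku Vu pu]]] := IH _ sS' Vfp Vy; exists u, (p.2 + k)%R; split=> //.
have -> : f^-1 * u = p.1 * ((f * p.1)^-1 * u) by rewrite invgM -mulgA mulVKg.
by apply: nonnegM ku; left; apply: QS.
Qed.

Definition far f g := forall k, Q (f^-1 * g) k.

Lemma far_le f g h : nonneg (f^-1 * g) 0%R -> far g h -> far f h.
Proof.
move=> fg gh k; have := nonneg_posM fg (gh k).
by rewrite add0r mulgA mulgK.
Qed.

Lemma far_translate f g h : far (f * g) (f * h) <-> far g h.
Proof. by rewrite /far invgM -mulgA mulKg. Qed.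

Lemma common_upper_bound (Z : seq F) : exists M, forall u, u \in Z -> nonneg (u^-1 * M) 0%R.
Proof.
pose r u v := `[< nonneg (u^-1 * v) 0%R >].
have [M _ MZ] : exists2 M, M \in 1 :: Z & {in 1 :: Z, forall u, r u M}.
  apply: (@seq_max _ r _ 1); last exact: mem_head.
    move=> u v; apply/orP; case: (nonneg_or (u^-1 * v) 0%R) => [uv|vu]; [left|right].
      exact/asboolP.
    by apply/asboolP; left; move: vu; rewrite invgM invgK oppr0.
  move=> v u h /asboolP uv /asboolP vh; apply/asboolP.
  by have := nonnegM uv vh; rewrite mulgA mulgK addr0.
by exists M => u uZ; apply/asboolP/MZ; rewrite inE uZ orbT.
Qed.

(** Take M above all crossing points.  An increasing path between two elements far
above M stays far above M, so it meets no crossing point. *)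
Lemma far_same_first_letter : exists M, forall g h, far M g -> far M h ->
  first_letter g = first_letter h.
Proof.
have [M MZ] := common_upper_bound (crossing_points [seq p.1 | p <- S]).
exists M => g h Mg Mh; have [//|/eqP neq] := eqVneq (first_letter g) (first_letter h).
wlog gh : g h Mg Mh neq / nonneg (g^-1 * h) 0%R => [hw|].
  case: (nonneg_or (g^-1 * h) 0%R) => [|hg]; first exact: hw.
  have hg' : nonneg (h^-1 * g) 0%R.
    by left; move: hg; rewrite invgM invgK oppr0.
  by apply/esym/(hw h g) => // e; apply: neq.
case: gh => [gh|[/mulg1_eq]]; last first.
  by rewrite invgK => e _; case: neq; rewrite e.
pose V u := first_letter u == first_letter g.
have [s [sS es _]] := Qgen gh.
have Vg : V g by apply/eqP.
have Vh : ~~ V (g * \prod_(p <- s) p.1).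
  by rewrite -es mulVKg; apply/eqP => e; apply: neq.
have [u [k [ku Vu [p pS Vup]]]] := walk_crossing sS Vg Vh.
have uZ : u \in crossing_points [seq p.1 | p <- S].
  apply: (@crossing_pointsP _ _ u p.1); first exact: map_f.
  by move=> e; move: Vup Vu; rewrite /V e => /negP.
case: Q0; have := nonneg_posM ku (far_le (MZ u uZ) Mg (- k)%R).
by rewrite mulgA mulgK mulVg subrr.
Qed.

(** Otherwise f^-1 lies above the whole centre, and there are elements g so large
that g, t1 g and t2 g all have the same first letter.  By [first_letterM], t g
and g can only agree in the first letter if that letter is t or t^-1, which
cannot hold for both t1 and t2. *)
Lemma centre_cofinal f : exists k, Q f k.
Proof.
apply: contrapT => /forallNP Nf.
have f1 : f <> 1 by move=> e; apply: (Nf 1%R); rewrite e.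
have farf : far 1 f^-1.
  move=> k; rewrite invg1 mul1g.
  have [|/(Nf _)//|] := @Qtot f (- k)%R; first by case.
  by rewrite opprK.
have [M MP] := far_same_first_letter.
pose b1 := (t1, false); pose b2 := (t2, false).
have [M' M'P] := common_upper_bound [:: M; (letter b1)^-1 * M; (letter b2)^-1 * M].
pose g := M' * f^-1.
have farg : far M' g by rewrite -[M'](mulg1) /g; apply/far_translate.
have Mg : far M g by apply: far_le farg; apply: M'P; rewrite inE eqxx.
have same b : b \in [:: b1; b2] -> first_letter (letter b * g) = first_letter g.
  move=> bb; apply: MP => //; rewrite -[M](mulVKg (letter b)); apply/far_translate.
  apply: far_le farg; apply: M'P; move: bb; rewrite !inE.
  by case/orP => /eqP ->; rewrite eqxx ?orbT.
have key b : b \in [:: b1; b2] -> omap fst (first_letter g) = Some b.1.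
  move=> bb; have := first_letterM b g; rewrite same //.
  case: first_letter => [c|] //=; rewrite !(inj_eq Some_inj).
  by case: eqVneq => [->|_ /esym/negbFE/eqP ->].
have := key b2; rewrite (key b1) ?inE ?eqxx ?orbT // => /(_ isT) [e].
by case/eqP: t12.
Qed.

Lemma height_exists : exists phi : F -> int, forall f k, nonneg f k <-> (phi f <= k)%R.
Proof.
suff /choice[phi phiP] : forall f, exists m : int, forall k, nonneg f k <-> (m <= k)%R.
  by exists phi.
have up f m (i : nat) : nonneg f m -> nonneg f (m + i%:Z)%R.
  elim: i => [|i IH] qm; first by rewrite addr0.
  have := nonnegM (IH qm) (or_introl Qz : nonneg 1 1%R); rewrite mulg1.
  by have -> : (m + i.+1 = m + i + 1)%R by lia.
move=> f; have [k1 q1] := centre_cofinal f; have [k2 q2] := centre_cofinal f^-1.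
have nq (k : int) : (k <= - k2)%R -> ~ nonneg f k.
  move=> kk2 /(@up _ _ (absz (- k2 - k)%R)).
  have -> : (k + (absz (- k2 - k))%:Z = - k2)%R by lia.
  by move/nonnegV; rewrite opprK.
have ex : exists i : nat, `[< nonneg f (- k2 + i%:Z)%R >].
  exists (absz (k1 + k2)%R); apply/asboolP; left.
  case: (lerP (k1 + k2)%R 0%R) => [kk|kk].
    by case: (@nq k1); [lia | left].
  by have -> : (- k2 + (absz (k1 + k2))%:Z = k1)%R by lia.
exists (- k2 + ex_minn ex)%R => k.
case: ex_minnP => i /asboolP qi imin; split=> [qk|ik]; last first.
  pose d : int := (k - (- k2 + i%:Z))%R; have := @up _ _ (absz d) qi.
  by have -> : (- k2 + i%:Z + (absz d)%:Z = k)%R by rewrite /d; lia.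
have k2k : (- k2 < k)%R by rewrite ltNge; apply/negP => /nq; apply.
have /imin : `[< nonneg f (- k2 + (absz (k + k2))%:Z)%R >].
  by apply/asboolP; have -> : (- k2 + (absz (k + k2))%:Z = k)%R by lia.
lia.
Qed.

End Height.

Lemma positive_cone_total (G : groupType) (P : set G) (x : G) :
  positive_cone P -> x != 1 -> P x \/ P x^-1.
Proof.
case=> _ tot _ _ _ x1; have : [set: G]%classic x by [].
rewrite -tot => -[[|[y Py <-]]|/eqP]; [by left|by right; rewrite invgK|by rewrite (negPf x1)].
Qed.

Lemma positive_cone_neq1 (G : groupType) (P : set G) : positive_cone P -> ~ P 1.
Proof.
case=> _ _ _ P1 _ P1'; have : (P `&` [set 1%g])%classic 1 by split.
by rewrite P1.
Qed.

(** The sign b makes the central generator positive. *)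
Lemma rank_even_of_cone (T : finType)
    (P : set (free_group T * Algebra.to_multiplicative int)%type) :
  (1 < #|T|)%N -> positive_cone P -> finitely_generated P -> ~~ odd #|T|.
Proof.
move=> /card_gt1P[t1 [t2 [_ _ t12]]] cP [S0 /finite_seqP[S0' ->] PS].
have PM : forall x y, P x -> P y -> P (x * y) by case: cP.
pose sg (b : bool) (m : int) : int := if b then (- m)%R else m.
have sgD b m k : sg b (m + k)%R = (sg b m + sg b k)%R by rewrite /sg; case: b => //; lia.
have sgN b m : sg b (- m)%R = (- sg b m)%R by rewrite /sg; case: b.
have sgK b : involutive (sg b) by move=> m; rewrite /sg; case: b => //; lia.
have [b Pz] : exists b, P (1, sg b 1%R).
  have [//|p|p] := @positive_cone_total _ P (1, 1%R) cP; first by exists false.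
  by exists true; move: p; congr (P (_, _)); apply: invg1.
pose Q f m := P (f, sg b m).
have QM f g m k : Q f m -> Q g k -> Q (f * g) (m + k)%R.
  by rewrite /Q sgD => p q; apply: PM p q.
have Q0 : ~ Q 1 0%R.
  have e : sg b 0%R = 0%R by rewrite /sg; case: (b).
  by rewrite /Q e => P1; apply: (positive_cone_neq1 cP).
have Qtot f m : (f, m) <> (1, 0%R) -> Q f m \/ Q f^-1 (- m)%R.
  move=> fm; rewrite /Q sgN; apply: (@positive_cone_total _ P (f, sg b m)) => //.
  apply/eqP => -[f1 m0]; apply: fm; rewrite f1 -[m](sgK b) m0.
  by rewrite /sg; case: (b).
pose S := [seq (y.1, sg b y.2) | y <- S0'].
have QS p : p \in S -> Q p.1 p.2.
  case/mapP => y yS -> /=; rewrite /Q sgK -surjective_pairing PS.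
  by exists [:: y]; split; rewrite ?big_seq1 // => z; rewrite inE => /eqP ->.
have Qgen f m : Q f m -> exists s, [/\ {subset s <= S},
    f = \prod_(p <- s) p.1 & m = (\sum_(p <- s) p.2)%R].
  rewrite /Q PS => -[s [_ sS e]]; exists [seq (y.1, sg b y.2) | y <- s]; split.
  - by move=> p /mapP[y ys ->]; apply/mapP; exists y => //; apply: sS.
  - rewrite big_map -[LHS]/((f, sg b m).1) e.
    by elim: (s) => [|y s' IH]; rewrite ?big_nil // !big_cons -IH.
  - rewrite big_map -[m](sgK b) -[X in sg b X]/((f, sg b m).2) e.
    elim: (s) => [|y s' IH]; first by rewrite !big_nil /sg; case: (b).
    by rewrite !big_cons -IH -sgD.
have [phi phiQ] := height_exists QM Q0 Qtot Pz QS Qgen t12.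
have phiP := height_functionP QM Q0 Qtot Pz phiQ.
have gS := height_generates QM Q0 Qtot Pz phiQ QS Qgen.
have f01 : fg_gen t1 != 1 by [].
have [|w wP] := least_positive_exists phiP f01 _ gS.
  by apply/mapP => -[p]; rewrite mem_filter => /andP[/eqP p1 _] e; apply: p1.
exact: (rank_even_of_least_positive (t1, false) phiP gS wP).
Qed.

(** * From a height function to a cone *)

Definition height_cone (G : groupType) (phi : G -> int) :
    set (G * Algebra.to_multiplicative int)%type :=
  [set x : (G * Algebra.to_multiplicative int)%type |
     (phi x.1 <= (x.2 : int))%R /\ x != 1]%classic.

Lemma height_cone_positive (G : groupType) (phi : G -> int) :
  height_function phi -> positive_cone (height_cone phi).
Proof.
move=> phiP; set P := height_cone phi.
have notboth x : P x -> ~ P x^-1.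
  case: x => f m [/= fm x1] [/= fm' _].
  have [f1|f1] := eqVneq f 1.
    have /eqP[] : (f, m) != 1 by [].
    move: fm fm'; rewrite f1 invg1 (phi1 phiP) => m0 m0'.
    have m0'' : (- (m : int) >= 0)%R by exact: m0'.
    by congr pair; change (@eq int m 0%R); lia.
  have fm'' : (phi f^-1%g <= - (m : int))%R by exact: fm'.
  by move: fm fm''; rewrite (phiV phiP f1); height_lia phi.
split.
- move=> x y Px Py; split; last first.
    by apply/negP; rewrite mulg_eq1 => /eqP xy; rewrite xy in Px; apply: notboth Py Px.
  case: Px Py => [px _] [py _]; apply: le_trans (phiM phiP _ _) _.
  exact: lerD px py.
- apply/seteqP; split=> // x _.
  have [->|x1] := eqVneq x 1; first by right.
  left; have [px|npx] := boolP (phi x.1 <= (x.2 : int))%R; first by left.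
  right; exists x^-1; last exact: invgK.
  split; last by rewrite invg_eq1.
  case: x x1 npx => f m /= x1 npx.
  have [f1|f1] := eqVneq f 1.
    move: npx; rewrite f1 invg1 (phi1 phiP) => npx.
    by change (0 <= - (m : int))%R; lia.
  change (phi f^-1%g <= - (m : int))%R; rewrite (phiV phiP f1).
  by height_lia phi.
- by apply/seteqP; split=> // x [Px [y Py yx]]; case: (notboth _ Py); rewrite yx.
- by apply/seteqP; split=> // x [[_ /eqP]].
- by apply/seteqP; split=> // x [[y [_ /eqP y1] <-] /= /eqP]; rewrite invg_eq1 => /eqP.
Qed.

Lemma semigroup_spanM (G : groupType) (S : set G) (x y : G) :
  semigroup_span S x -> semigroup_span S y -> semigroup_span S (x * y).
Proof.
move=> [s [s0 sS ->]] [t [t0 tS ->]]; exists (s ++ t); split.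
- by case: (s) s0.
- by move=> z; rewrite mem_cat => /orP[/sS|/tS].
- by rewrite big_cat.
Qed.

Lemma semigroup_span_sub (G : groupType) (S : set G) (x : G) :
  S x -> semigroup_span S x.
Proof.
by move=> Sx; exists [:: x]; split; rewrite ?big_seq1 // => z; rewrite inE => /eqP ->.
Qed.

Lemma semigroup_span_min (G : groupType) (S P : set G) (x : G) :
  (forall y, S y -> P y) -> (forall y z, P y -> P z -> P (y * z)) ->
  semigroup_span S x -> P x.
Proof.
move=> SP PM [[|y s] [// _ + ->]]; elim: s y => [|y' s IH] y ys.
  by rewrite big_seq1; apply/SP/ys; rewrite mem_head.
rewrite big_cons; apply: PM; first by apply/SP/ys; rewrite mem_head.
by apply: IH => z zs; apply: ys; rewrite inE zs orbT.
Qed.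

Lemma not_sorted_split (X : Type) (r : rel X) (s : seq X) : ~~ sorted r s ->
  exists s1 a b s2, s = s1 ++ [:: a, b & s2] /\ ~~ r a b.
Proof.
elim: s => //= a [|b s] IH //=; rewrite negb_and => /orP[nab|/IH].
  by exists [::], a, b, s.
by move=> [s1 [c [d [s2 [-> ncd]]]]]; exists (a :: s1), c, d, s2.
Qed.

(** * Height functions from arrangements of the letters *)

Section Winding.
Variables (T : finType) (pos rank : T * bool -> nat) (R : nat).
Implicit Types (a b c d : T * bool) (s t u v : seq (T * bool)).
Hypothesis pos_inj : injective pos.

(** At a vertex of a path a b in the Cayley tree, the path comes in along a^-1 and
leaves along b; it makes a turn if b is placed after a^-1.  The base point of the
vertex is thought of as placed before all letters. *)
Definition turn a b : bool := (pos (letter_inv a) < pos b)%N.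

(** Lifting each generator x to (x, 0), each turn lowers the boundary of the cone
by one, and each inverse letter raises it by one. *)
Fixpoint winding s : int :=
  if s is a :: s' then
    ((a.2 : nat)%:Z - (if s' is b :: _ then (turn a b : nat)%:Z else 0) + winding s')%R
  else 0%R.

Lemma winding_cat u a b v :
  winding (rcons u a ++ b :: v) =
    (winding (rcons u a) + winding (b :: v) - (turn a b : nat)%:Z)%R.
Proof.
elim: u => [|c u IH] /=; first by lia.
move: IH; case: u => [|d u] /=; lia.
Qed.

Lemma turnV a b : b != letter_inv a -> turn (letter_inv b) (letter_inv a) = ~~ turn a b.
Proof.
move=> ab; rewrite /turn letter_invK -leqNgt [RHS]leq_eqVlt (inj_eq pos_inj).
by rewrite (negPf ab).
Qed.

Lemma inv_word_cons a s : inv_word (a :: s) = rcons (inv_word s) (letter_inv a).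
Proof. by rewrite /inv_word /= rev_cons. Qed.

(** The inverse path makes a turn exactly where the path makes none, and a word of
length l has l - 1 interior vertices. *)
Lemma winding_inv s : reduced s -> s != [::] -> winding (inv_word s) = (1 - winding s)%R.
Proof.
elim: s => // a [|b s] IH rs _; first by case: a {rs} => t [].
have /= /andP[ab rs'] := rs.
have {}IH := IH rs' isT.
rewrite !inv_word_cons -(cats1 (rcons _ _)) winding_cat -inv_word_cons IH turnV //=.
by case: (a) => t [] /=; case: turn => /=; lia.
Qed.

Lemma mul_word_split s t : reduced s -> reduced t ->
  exists u s' v, [/\ s = u ++ s', t = inv_word s' ++ v & mul_word s t = u ++ v].
Proof.
move=> + rt; elim: s => [|a s IH] rs; first by exists [::], [::], t.
have [u [s' [v [es et e]]]] := IH (path_sorted rs).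
rewrite /= -/(mul_word s t) e; case: u es e => [|b u] es e; last first.
  exists (a :: b :: u), s', v; split=> //=; first by rewrite es.
  by move: rs; rewrite es /= => /andP[/negPf ->].
case: v et e => [|b v] et e; first by exists [:: a], s', [::]; rewrite es.
rewrite /=; case: eqVneq => [eb|_]; last by exists [:: a], s', (b :: v); rewrite es.
exists [::], (a :: s'), v; split=> //; first by rewrite es.
by rewrite inv_word_cons cat_rcons -eb.
Qed.

(** Cancelling s' loses winding s' + winding (inv_word s') = 1.  This is affordable:
if the vertex where the paths branch has the turns a c and c^-1 b, that is
pos a^-1 < pos c < pos b, then a b is a turn as well. *)
Lemma winding_mul s t : reduced s -> reduced t ->
  (winding (mul_word s t) <= winding s + winding t)%R.
Proof.
move=> rs rt; have [u [s' [v [es et ->]]]] := mul_word_split rs rt.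
rewrite {s}es {t}et in rs rt *.
case: s' rs rt => [|c s] rs rt; rewrite ?cats0.
  case/lastP: u rs => [|u a] rs; first by rewrite /= add0r.
  case: v rt => [|b v] rt; first by rewrite cats0 addr0.
  rewrite -[inv_word [::] ++ _]/(b :: v) winding_cat; lia.
have rc : reduced (c :: s).
  by move: rs; rewrite /reduced => /cat_sorted2[].
have := winding_inv rc isT; rewrite inv_word_cons.
case/lastP: u rs => [|u a] rs; case: v rt => [|b v] rt; rewrite ?cats0 ?cat0s ?winding_cat.
- by move=> -> /=; lia.
- by move=> ->; case: (turn _ _); lia.
- by move=> ->; case: (turn _ _); lia.
move=> ->; rewrite /turn letter_invK.
by case: ltnP; case: ltnP; case: ltnP; lia.
Qed.

Definition fg_winding (f : free_group T) : int := winding f.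

Lemma winding_height : height_function fg_winding.
Proof.
split=> // [f g|f f1]; first exact: winding_mul (fg_reduced f) (fg_reduced g).
apply: winding_inv; first exact: fg_reduced.
by apply: contra f1 => /eqP e; apply/eqP/val_inj.
Qed.

Hypothesis rank_lt : forall a, (rank a < R)%N.
(** A turn without a letter strictly between is a step along the boundary of the
surface, and raises the rank. *)
Hypothesis between : forall a b, turn a b ->
  (rank a < rank b)%N \/ exists2 d, turn a d & (pos d < pos b)%N.

Local Notation E := (free_group T * Algebra.to_multiplicative int)%type.

Definition word_lift s : E := (eval_word s, winding s).

Definition centre_gen : E := (1, 1%R : int).

Definition short_lifts : set E :=
  ([set word_lift s | s in [set s | [/\ reduced s, s != [::] & (size s <= R.+2)%N]]]
   `|` [set centre_gen])%classic.

Lemma finite_short_lifts : finite_set short_lifts.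
Proof.
rewrite finite_setU; split; last exact: finite_set1.
apply: finite_image.
apply: (@sub_finite_set _ _ ((fun b : {bseq R.+2 of T * bool} => b : seq _) @` setT)%classic).
  by move=> s [_ _ sR]; exists (Bseq sR).
exact/finite_image/finite_finset.
Qed.

Lemma descent_word s : (R < size s)%N ->
  exists s1 a b s2, s = s1 ++ [:: a, b & s2] /\ ~~ (rank a < rank b)%N.
Proof.
move=> Rs; apply: (@not_sorted_split _ (fun a b => rank a < rank b)%N).
apply: contraL Rs => srt; rewrite -leqNgt -(size_map rank) -[R in (_ <= R)%N](size_iota 0).
apply: uniq_leq_size; first by apply: (sorted_uniq ltn_trans ltnn); rewrite sorted_map.
by move=> _ /mapP[a _ ->]; rewrite mem_iota rank_lt.
Qed.

Lemma word_liftM s t w' : eval_word w' = eval_word s * eval_word t ->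
  winding w' = (winding s + winding t)%R -> word_lift w' = word_lift s * word_lift t.
Proof. by rewrite /word_lift => -> ->. Qed.

(** Words of length greater than R + 2 can be split.  The first and the last letter
are set aside, so that inserting d d^-1 at an interior vertex leaves two words
shorter than the given one; along the remaining more than R letters the rank
cannot increase all the time. *)
Lemma word_lift_span s : reduced s -> s != [::] -> semigroup_span short_lifts (word_lift s).
Proof.
have [N sN] := ubnP (size s); elim: N s sN => // N IH s sN rs s0.
have [sR|Rs] := leqP (size s) R.+2.
  by apply: semigroup_span_sub; left; exists s.
case: s Rs sN rs s0 => // x s; case/lastP: s => // s y.
rewrite /= size_rcons !ltnS => Rs sN + _.
have [s1 [a [b [s2 [es /negP nrank]]]]] := descent_word Rs.
rewrite -cats1 {s}es in Rs sN *.
have e : x :: (s1 ++ [:: a, b & s2]) ++ [:: y] = rcons (x :: s1) a ++ b :: rcons s2 y.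
  by rewrite -[rcons s2 y]cats1 cat_rcons /= -catA.
rewrite size_cat /= in sN; rewrite e.
move=> rs; have {}rs : reduced (rcons (x :: s1) a ++ b :: rcons s2 y) by rewrite -e.
have [ra rb] := cat_sorted2 rs.
have [/between[//|[d ad db]]|nab] := boolP (turn a b); last first.
  rewrite (@word_liftM (rcons (x :: s1) a) (b :: rcons s2 y)); last first.
  - by rewrite winding_cat (negPf nab) subr0.
  - by rewrite eval_word_cat.
  by apply: semigroup_spanM; apply: IH => //; rewrite /= ?size_rcons; lia.
pose u := rcons (rcons (x :: s1) a) d; pose v := letter_inv d :: b :: rcons s2 y.
have ad' : d != letter_inv a by apply: contraTneq ad => ->; rewrite /turn ltnn.
have db' : b != letter_inv (letter_inv d).
  by apply: contraTneq db => ->; rewrite letter_invK ltnn.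
have tab : turn a b by apply: ltn_trans ad db.
have tdb : turn (letter_inv d) b by rewrite /turn letter_invK.
rewrite (@word_liftM u v); last first.
- rewrite /u /v -[rcons (rcons _ _) d]cats1 !winding_cat /= tab ad tdb.
  by case: (d) => t [] /=; lia.
- have -> : eval_word u = eval_word (rcons (x :: s1) a) * letter d.
    rewrite /u -cats1 eval_word_cat; congr (_ * _).
    by rewrite eval_word_cons [eval_word [::]]big_nil mulg1.
  by rewrite /v [eval_word (letter_inv d :: _)]eval_word_cons letterV mulgA mulgK eval_word_cat.
apply: semigroup_spanM; apply: IH => //.
- by rewrite /u !size_rcons /=; lia.
- by rewrite /reduced /u /= rcons_path last_rcons ad' andbT.
- by rewrite /v /= size_rcons; lia.
by rewrite /reduced /v /= db'.
Qed.

Lemma height_cone_generated :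
  height_cone fg_winding = semigroup_span short_lifts.
Proof.
have zS : semigroup_span short_lifts centre_gen by apply: semigroup_span_sub; right.
have powz (k : nat) x : semigroup_span short_lifts x ->
    semigroup_span short_lifts (x.1, (x.2 : int) + k%:Z : int)%R.
  move=> Sx; elim: k => [|k IH]; first by rewrite addr0 -surjective_pairing.
  have := semigroup_spanM IH zS; congr (semigroup_span _ (_, _)).
    by rewrite /= mulg1.
  by change (x.2 + k%:Z + 1 = x.2 + k.+1%:Z :> int)%R; lia.
apply/seteqP; split=> [[f m] [/= fm fm1]|x].
  have [f1|f1] := eqVneq f 1.
    have m0 : (0 < m :> int)%R.
      rewrite lt_neqAle; move: fm; rewrite f1 /fg_winding /= => ->; rewrite andbT.
      by apply: contraNneq fm1 => <-; rewrite f1.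
    have := powz (absz ((m : int) - 1)) _ zS; congr (semigroup_span _ (_, _)) => //.
    by rewrite /=; lia.
  have S1 : semigroup_span short_lifts (word_lift f).
    apply: word_lift_span; first exact: fg_reduced.
    by apply: contra f1 => /eqP e; apply/eqP/val_inj.
  have := powz (absz ((m : int) - winding f)) _ S1.
  congr (semigroup_span _ (_, _)); first exact: fg_wordK.
  by move: fm; rewrite /fg_winding /=; lia.
have [PM _ _ _ _] := height_cone_positive winding_height.
apply: semigroup_span_min => [y|]; last exact: PM.
case=> [[s [rs s0 _] <-]|->]; split=> //=.
  by rewrite /fg_winding eval_word_reduced.
apply/eqP => -[/(congr1 (@fg_word T))] /=; rewrite eval_word_reduced // => e.
by rewrite e in s0.
Qed.

End Winding.

(** * The surface with one boundary circle *)

Section EvenRank.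
Variable n : nat.
Implicit Types a b : 'I_n * bool.

(** The arrangement x, y, x^-1, y^-1 in blocks of four, where x and y are the
generators of index 2 j and 2 j + 1. *)
Definition surface_pos a : nat := (4 * (a.1)./2 + odd a.1 + 2 * a.2)%N.

(** The boundary of the surface visits x, y^-1, x^-1, y in the first block, then
the same letters of the next one. *)
Definition surface_rank a : nat :=
  (4 * (a.1)./2 + (if odd a.1 then if a.2 then 1 else 3 else 2 * a.2))%N.

Lemma surface_pos_inj : injective surface_pos.
Proof.
move=> [i b] [j c]; rewrite /surface_pos /= => e.
have ei := odd_double_half i; have ej := odd_double_half j.
have [eb eo eh] : [/\ b = c, odd i = odd j & i./2 = j./2].
  by case: b c (odd i) (odd j) e {ei ej} => [] [] [] []; split=> //; lia.
by rewrite eb; congr pair; apply/val_inj; rewrite /= -ei -ej eo eh.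
Qed.

Hypothesis n_even : ~~ odd n.

Lemma surface_rank_lt a : (surface_rank a < 2 * n)%N.
Proof.
case: a => i b; rewrite /surface_rank /=; have := ltn_ord i.
have := odd_double_half i; have := odd_double_half n; rewrite (negPf n_even).
by case: b; case: (odd i); lia.
Qed.

(** For odd n the last block would lack its second and fourth letter. *)
Lemma surface_pos_surj (p : nat) : (p < 2 * n)%N -> exists a, surface_pos a = p.
Proof.
move=> pn; pose i := (odd p + (p %/ 4).*2)%N.
have i_lt : (i < n)%N.
  have := odd_double_half n; rewrite (negPf n_even) /i; have := modn2 p; lia.
exists (Ordinal i_lt, 1 < p %% 4)%N; rewrite /surface_pos /=.
rewrite half_bit_double oddD odd_double addbF oddb; have := modn2 p; lia.
Qed.

Lemma surface_pos_lt a : (surface_pos a < 2 * n)%N.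
Proof.
case: a => i b; rewrite /surface_pos /=; have := ltn_ord i.
have := odd_double_half i; have := odd_double_half n; rewrite (negPf n_even).
by case: b; case: (odd i); lia.
Qed.

Lemma surface_between a b : turn surface_pos a b ->
  (surface_rank a < surface_rank b)%N \/
  exists2 d, turn surface_pos a d & (surface_pos d < surface_pos b)%N.
Proof.
rewrite /turn => ab; have [d ed] : exists d, surface_pos d = (surface_pos (letter_inv a)).+1.
  by apply/surface_pos_surj/(leq_ltn_trans ab)/surface_pos_lt.
have [db|bd] := ltnP (surface_pos d) (surface_pos b).
  by right; exists d; rewrite // ed.
left; have {ab bd ed d} : surface_pos b = (surface_pos (letter_inv a)).+1.
  by apply/eqP; rewrite eqn_leq ab andbT -ed.
case: a b => [i c] [j e]; rewrite /surface_pos /surface_rank /letter_inv /=.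
move: (i./2) (j./2) (odd i) (odd j) c e => i' j' [] [] [] [] /=; lia.
Qed.

End EvenRank.

Theorem corollary1p2 (n : nat) (hn : (2 <= n)%N) :
  (exists P : set (free_group 'I_n * Algebra.to_multiplicative int)%type,
     positive_cone P /\ finitely_generated P) <-> ~~ odd n.
Proof.
split=> [[P [coneP fgP]]|n_even].
  by have := rank_even_of_cone _ coneP fgP; rewrite card_ord; apply.
exists (height_cone (fg_winding (@surface_pos n))); split.
  exact/height_cone_positive/winding_height/surface_pos_inj.
exists (short_lifts (@surface_pos n) (2 * n)); first exact: finite_short_lifts.
exact: (height_cone_generated (@surface_pos_inj n) (surface_rank_lt n_even)
         (surface_between n_even)).
Qed.
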